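(* Let $\alpha>1$, $\beta>0$, $A_\circ>0$, $R_{\mathrm{y}}>0$, $\lambda_{\mathrm{y}}>0$, $p_{\mathrm{I}}\in[0,1]$. Let $\mathbf{x}_{\mathrm{rx}}=x_{\mathrm{rx}}\mathbf{e}_{\mathrm{x}}$ with $x_{\mathrm{rx}}\in\mathbb{R}$, and let $\mathbf{x}_{\mathrm{tx}}=x_{\mathrm{tx}}\mathbf{e}_{\mathrm{x}}+y_{\mathrm{tx}}\mathbf{e}_{\mathrm{y}}$ with $x_{\mathrm{tx}},y_{\mathrm{tx}}\in\mathbb{R}$, $x_{\mathrm{tx}}y_{\mathrm{tx}}=0$ and $\mathbf{x}_{\mathrm{tx}}\neq\mathbf{x}_{\mathrm{rx}}$. With the suburban path loss $\ell_{\mathrm{pl}}=\ell_{\mathrm{pl}}^{\mathrm{s}}$, put $\zeta_{\mathrm{s}}=\beta^{1/\alpha}\|\mathbf{x}_{\mathrm{rx}}-\mathbf{x}_{\mathrm{tx}}\|$. Then the quantity $\mathcal{P}_\circ(\Phi_{\mathrm{y}})$ (defined in the context) satisfies $$\mathcal{P}_\circ(\Phi_{\mathrm{y}})=\exp\bigl(-p_{\mathrm{I}}\lambda_{\mathrm{y}}\zeta_{\mathrm{s}}\,\mathcal{Y}(R_{\mathrm{y}})\bigr),\qquad \mathcal{Y}(R_{\mathrm{y}})=h_\circ\Bigl(\alpha,\bigl(\|\mathbf{x}_{\mathrm{rx}}\|/\zeta_{\mathrm{s}}\bigr)^2,\bigl(R_{\mathrm{y}}/\zeta_{\mathrm{s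}}\bigr)^2\Bigr).$$
   Context: Notation: $\mathbf{e}_{\mathrm{x}}=[1\ 0]^{\mathrm T}$, $\mathbf{e}_{\mathrm{y}}=[0\ 1]^{\mathrm T}$; $\|\cdot\|$ is the Euclidean norm on $\mathbb{R}^2$. Suburban path loss: $\ell_{\mathrm{pl}}^{\mathrm{s}}(\mathbf{x},\mathbf{x}_{\mathrm{rx}})=A_\circ\|\mathbf{x}_{\mathrm{rx}}-\mathbf{x}\|^{-\alpha}$ for $\mathbf{x}\neq\mathbf{x}_{\mathrm{rx}}$. Interferers: $\Phi_{\mathrm{y}}$ is the set of random points $y\mathbf{e}_{\mathrm{y}}$ on the vertical road, where the coordinates $y$ form a homogeneous Poisson point process of intensity $p_{\mathrm{I}}\lambda_{\mathrm{y}}$ on $\mathcal{B}_{\mathrm{y}}=\{y\in\mathbb{R}: |y|\le R_{\mathrm{y}}\}$. To each point $\mathbf{x}\in\Phi_{\mathrm{y}}$ is attached a fading variable $\ell_{\mathrm{f}}(\mathbf{x})$; these are i.i.d. exponential of mean $1$ and independent of $\Phi_{\mathrm{y}}$. The normalized aggregate interference is $I(\Phi_{\mathrm{y}})=\sum_{\mathbf{x}\in\Phi_{\mathrm{y}}}\ell_{\mathrm{f}}(\mathbf{x})\,\ell_{\mathrm{pl}}(\mathbf{x},\mathbf{x}_{\mathrm{rx}})$. Definition: $\mathcal{P}_\circ(\Phi_{\mathrm{y}})=\mathbb{E}\{\exp(-\beta' I(\Phi_{\mathrm{y}}))\}$, where $\beta'=\beta/\ell_{\mathrm{pl}}(\mathbf{x}_{\mathrm{tx}},\mathbf{x}_{\mathrm{rx}})$.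 The function $h_\circ$: for $\alpha>0$, $\delta\ge0$, $\vartheta\ge 0$, $h_\circ(\alpha,\delta,\vartheta)=\int_{\delta}^{\vartheta+\delta}\frac{\mathrm{d}u}{\sqrt{u-\delta}\,(1+u^{\alpha/2})}$. *)

(* Defs.v *)
From HB Require Import structures.
From mathcomp Require Import all_boot all_order all_algebra finmap.
From mathcomp Require Import all_classical all_reals all_analysis.

Set Implicit Arguments.
Unset Strict Implicit.
Unset Printing Implicit Defensive.

Import Order.TTheory GRing.Theory Num.Theory.
Import numFieldNormedType.Exports.

Local Open Scope classical_set_scope.
Local Open Scope ring_scope.

Section Plane.
Context {R : realType}.

Definition ex : 'cV[R]_2 := delta_mx 0 0.
Definition ey : 'cV[R]_2 := delta_mx 1 0.

(* The library norm on matrices is the sup norm, hence this definition. *)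
Definition enorm (x : 'cV[R]_2) : R := Num.sqrt (\sum_i x i 0 ^+ 2).

(* Meaningful for x != xrx; since 0 `^ (- alpha) = 0 for alpha != 0, the value
   at x = xrx is 0. *)
Definition suburban_path_loss (A0 alpha : R) (x xrx : 'cV[R]_2) : R :=
  A0 * enorm (xrx - x) `^ (- alpha).

(* Lebesgue integral; the integrand has an integrable singularity at delta,
   where its value is 0 by the convention 0^-1 = 0. *)
Definition h_circ (alpha delta theta : R) : R :=
  \int[lebesgue_measure]_(u in `[delta, theta + delta])
    (Num.sqrt (u - delta) * (1 + u `^ (alpha / 2)))^-1.

End Plane.

Section Independence.
Context d (T : measurableType d) (R : realType) (P : probability T R).

Definition mutually_independent d' (T' : measurableType d') (I : choiceType)
    (X : I -> T -> T') : Prop :=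
  forall (J : {fset I}) (A : I -> set T'), (forall j, measurable (A j)) ->
    P (\bigcap_(j in [set` J]) (X j @^-1` A j)) =
    (\prod_(j <- J) P (X j @^-1` A j))%E.

Definition independent_systems (G H : set (set T)) : Prop :=
  forall A B, G A -> H B -> P (A `&` B) = (P A * P B)%E.

Definition sigma_family d' (T' : measurableType d') (I : Type)
    (X : I -> T -> T') : set (set T) :=
  <<s \bigcup_i g_sigma_algebra_preimage (X i) >>.

End Independence.

(* A point process with finitely many points is given by an enumeration: its
   number of points N and locations Y 0, ..., Y (N - 1); the values of Y i for
   i >= N carry no meaning and may be set to 0. *)
Section PointProcess.
Context d (T : measurableType d) (R : realType) (P : probability T R).

Definition point_count (N : T -> nat) (Y : nat -> T -> R) (B : set R)
    (w : T) : nat := (\sum_(i < N w) (Y i w \in B))%N.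

(* Homogeneous Poisson point process of intensity lambda on a Borel set D of
   finite length. Counts are taken with multiplicity, so distinctness of the
   points is not part of the definition: it holds almost surely. The second
   argument of poisson_prob is a dummy; poisson_prob 0 is the Dirac measure
   at 0. *)
Definition homogeneous_poisson_process (lambda : R) (D : set R)
    (N : {RV P >-> nat}) (Y : nat -> {RV P >-> R}) : Prop :=
  [/\ (forall w i, (i < N w)%N -> D (Y i w)),
      (forall B, measurable B -> B `<=` D -> forall K : set nat,
         P (point_count N Y B @^-1` K) =
         poisson_prob (lambda * fine (lebesgue_measure B)) 0%N K) &
      (forall n (B : 'I_n -> set R),
         (forall i, measurable (B i) /\ B i `<=` D) -> trivIset setT B ->
         mutually_independent P (fun i => point_count N Y (B i)))].

(* i.i.d. marks of exponential law with mean 1, F i being attached to the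
   i-th point, independent of the enumerated point process. *)
Definition iid_exponential_marks (N : {RV P >-> nat})
    (Y : nat -> {RV P >-> R}) (F : nat -> {RV P >-> R}) : Prop :=
  [/\ (forall i A, measurable A -> distribution P (F i) A =
                                   exponential_prob 1 A),
      mutually_independent P (fun i => F i : T -> R) &
      independent_systems P
        (sigma_family (fun i => F i : T -> R))
        <<s g_sigma_algebra_preimage N `|`
            sigma_family (fun i => Y i : T -> R) >>].

Definition interference (lpl : 'cV[R]_2 -> 'cV[R]_2 -> R) (xrx : 'cV[R]_2)
    (N : T -> nat) (X : nat -> T -> 'cV[R]_2) (F : nat -> T -> R) (w : T) : R :=
  \sum_(i < N w) F i w * lpl (X i w) xrx.

Definition P_circ (beta : R) (lpl : 'cV[R]_2 -> 'cV[R]_2 -> R)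
    (xtx xrx : 'cV[R]_2) (N : T -> nat) (X : nat -> T -> 'cV[R]_2)
    (F : nat -> T -> R) : \bar R :=
  let beta' := beta / lpl xtx xrx in
  'E_P[fun w => expR (- beta' * interference lpl xrx N X F w)]%E.

End PointProcess.

(* Main.v *)
Require Import Defs.
From HB Require Import structures.
From mathcomp Require Import all_boot all_order all_algebra finmap.
From mathcomp Require Import all_classical all_reals all_analysis.
From mathcomp Require Import measurable_realfun.
From mathcomp Require Import ring lra.

Set Implicit Arguments.
Unset Strict Implicit.
Unset Printing Implicit Defensive.

Import Order.TTheory GRing.Theory Num.Theory.
Import numFieldNormedType.Exports.

Local Open Scope classical_set_scope.
Local Open Scope ring_scope.

(* For a path loss taking finitely many values a_j, on cells B_j of the road,
   condition on the number of points and on the cells they fall in: by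
   independence of the marks each point of B_j contributes the exponential
   Laplace transform c_j = 1 / (1 + a_j). The product over the points is then
   \prod_j c_j ^ K_j with K_j the number of points in B_j, and independence of
   the Poisson counts K_j gives exp (- lambda \sum_j |B_j| (1 - c_j)). Simple
   functions increasing to an arbitrary nonnegative l and dominated convergence
   yield the Laplace functional
     E exp (- \sum_i F_i l(Y_i)) = exp (- lambda \int (1 - 1 / (1 + l))),
   and u = delta + (y / zeta)^2 turns the last integral into h_circ. *)

Lemma measurable_indic_comp d d' (T : measurableType d) (S : measurableType d')
    (R : realType) (X : T -> S) (A : set S) :
  measurable_fun setT X -> measurable A ->
  measurable_fun setT (fun w => \1_A (X w) : R).
Proof.
move=> mX mA; apply: (measurableT_comp (f := (\1_A : S -> R)) _ mX).
exact: measurable_indic.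
Qed.

(** * Integrals under transferred measures and independence *)

Section integral_transfer.
Local Open Scope ereal_scope.
Context d d' (T : measurableType d) (S : measurableType d') (R : realType).
Variables (mu : {measure set T -> \bar R}) (nu : {measure set S -> \bar R}).
Variables (X : T -> S) (Z : T -> R) (c : R).
Hypothesis mX : measurable_fun setT X.
Hypothesis mZ : measurable_fun setT Z.
Hypothesis Z_ge0 : forall w, (0 <= Z w)%R.
Hypothesis c_ge0 : (0 <= c)%R.
Hypothesis transfer_indic : forall A, measurable A ->
  \int[mu]_w (Z w * \1_A (X w))%:E = c%:E * nu A.

Import HBNNSimple.

(* The maximum with 0 only makes the summands nonnegative at the values y outside
   the range of h, as ge0_integral_fsum requires. *)
Lemma nnsfun_integral_transfer (h : {nnsfun S >-> R}) :
  \int[mu]_w (Z w * h (X w))%:E = c%:E * \int[nu]_x (h x)%:E.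
Proof.
have mA y : measurable (h @^-1` [set y]) by [].
have mZA y : measurable_fun setT (fun w => (Z w * \1_(h @^-1` [set y]) (X w))%R).
  apply: measurable_funM => //.
  exact: measurable_indic_comp.
have y0 y : (y \in range h) -> (0 <= y)%R.
  by rewrite inE => -[x _ <-].
have hE w : (Z w * h (X w))%:E =
    \sum_(y \in range h)
       ((Num.max y 0)%:E * (Z w * \1_(h @^-1` [set y]) (X w))%:E).
  rewrite (fimfunE h (X w)) EFinM -fsumEFin// ge0_mule_fsumr; last first.
    by move=> y; rewrite EFinM nnfun_muleindic_ge0.
  apply: eq_fsbigr => y yh.
  by rewrite max_l ?y0// -!EFinM; congr EFin; ring.
under eq_integral do rewrite hE.
rewrite ge0_integral_fsum//; last 2 first.
- move=> y; apply: emeasurable_funM => //.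
  by apply/measurable_EFinP; exact: mZA.
- move=> y w _; apply: mule_ge0; first by rewrite lee_fin le_max lexx orbT.
  by rewrite lee_fin mulr_ge0.
rewrite integralT_nnsfun sintegralE ge0_mule_fsumr; last first.
  by move=> y; exact: nnsfun_mulemu_ge0.
apply: eq_fsbigr => y yh; rewrite max_l ?y0// ge0_integralZl//.
- by rewrite transfer_indic// muleCA.
- exact/measurable_EFinP/mZA.
- by move=> w _; rewrite lee_fin mulr_ge0.
- by rewrite lee_fin y0.
Qed.

(** Monotone convergence on both sides extends the identity from simple functions. With [X = id] and
    [Z] a density, it is integration against that density; with [nu] the law of [X], it says that
    [Z] is uncorrelated with every function of [X]. *)
Lemma ge0_integral_transfer (f : S -> R) :
  measurable_fun setT f -> (forall x, (0 <= f x)%R) ->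
  \int[mu]_w (Z w * f (X w))%:E = c%:E * \int[nu]_x (f x)%:E.
Proof.
move=> mf f0.
have mEf : measurable_fun setT (EFin \o f) by exact/measurable_EFinP.
pose h := nnsfun_approx measurableT mEf.
have hf x : (h n x)%:E @[n --> \oo] --> (f x)%:E.
  by apply: cvg_nnsfun_approx => // y _; rewrite lee_fin.
have h_nd x m n : (m <= n)%N -> (h m x <= h n x)%R.
  by move=> mn; exact/lefP/nd_nnsfun_approx.
have mZh n : measurable_fun setT (fun w => (Z w * h n (X w))%:E).
  apply/measurable_EFinP; apply: measurable_funM => //.
  exact: measurableT_comp.
have L : \int[mu]_w (Z w * h n (X w))%:E @[n --> \oo] -->
         \int[mu]_w (Z w * f (X w))%:E.
  rewrite (_ : \int[mu]_w (Z w * f (X w))%:E =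
    \int[mu]_w (limn (fun n => (Z w * h n (X w))%:E))).
    apply: cvg_monotone_convergence => //.
      by move=> n w _; rewrite lee_fin mulr_ge0.
    by move=> w _ m n mn; rewrite lee_fin ler_wpM2l// h_nd.
  apply: eq_integral => w _; apply/esym/cvg_lim => //.
  under eq_fun do rewrite EFinM; rewrite EFinM.
  by apply: cvgeZl => //; exact: hf.
have K : \int[nu]_x (h n x)%:E @[n --> \oo] --> \int[nu]_x (f x)%:E.
  rewrite (_ : \int[nu]_x (f x)%:E =
    \int[nu]_x (limn (fun n => (h n x)%:E))).
    apply: cvg_monotone_convergence => //.
    - by move=> n; exact/measurable_EFinP.
    - by move=> n w _; rewrite lee_fin.
    - by move=> w _ m n mn; rewrite lee_fin h_nd.
  by apply: eq_integral => x _; apply/esym/cvg_lim.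
have K' : c%:E * \int[nu]_x (h n x)%:E @[n --> \oo] -->
    c%:E * \int[nu]_x (f x)%:E by exact: cvgeZl.
rewrite (_ : (fun n => \int[mu]_w (Z w * h n (X w))%:E) =
    (fun n => c%:E * \int[nu]_x (h n x)%:E)) in L; last first.
  by apply/funext => n; exact: nnsfun_integral_transfer.
exact: (cvg_unique _ L K').
Qed.

End integral_transfer.

(** * Expectations of products of independent factors *)

Section independence_product.
Context d d' (T : measurableType d) (S : measurableType d') (R : realType).
Variable P : probability T R.

Lemma integral_mul_indep (X : {RV P >-> S}) (Z : T -> R) (c m : R) (f : S -> R) :
  measurable_fun setT Z -> (forall w, 0 <= Z w) -> 0 <= c ->
  measurable_fun setT f -> (forall x, 0 <= f x) ->
  (\int[P]_w (f (X w))%:E = m%:E)%E ->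
  (forall A, measurable A -> \int[P]_w (Z w * \1_A (X w))%:E =
    (c * fine (P (X @^-1` A)))%:E)%E ->
  (\int[P]_w (Z w * f (X w))%:E = (c * m)%:E)%E.
Proof.
move=> mZ Z0 c0 mf f0 fm ZA.
rewrite (@ge0_integral_transfer _ _ _ _ _ P (distribution P X) X Z c)//.
- rewrite (ge0_integral_distribution X (f := EFin \o f))//.
    by rewrite fm -EFinM.
  exact/measurable_EFinP.
- move=> A mA; rewrite ZA// EFinM fineK//.
  by apply: fin_num_measure; exact: measurable_funPTI.
Qed.

(* The weight Z makes the induction go through: the last factor is absorbed into
   it. *)
Lemma integral_prod_indep n : forall (X : nat -> {RV P >-> S}) (Z : T -> R) (c : R)
    (f : nat -> S -> R) (m : nat -> R),
  measurable_fun setT Z -> (forall w, 0 <= Z w) -> 0 <= c ->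
  (forall i, measurable_fun setT (f i)) -> (forall i x, 0 <= f i x) ->
  (forall i, \int[P]_w (f i (X i w))%:E = (m i)%:E)%E ->
  (forall A : nat -> set S, (forall i, measurable (A i)) ->
    \int[P]_w (Z w * \prod_(i < n) \1_(A i) (X i w))%:E =
    (c * \prod_(i < n) fine (P (X i @^-1` A i)))%:E)%E ->
  (\int[P]_w (Z w * \prod_(i < n) f i (X i w))%:E = (c * \prod_(i < n) m i)%:E)%E.
Proof.
elim: n => [|n IH] X Z c f m mZ Z0 c0 mf f0 fm ZA.
  have := ZA (fun=> setT) (fun=> measurableT).
  rewrite !big_ord0 => <-.
  by apply: eq_integral => w _; rewrite !big_ord0.
have mfX i : measurable_fun setT (fun w => f i (X i w)) by exact: measurableT_comp.
have m0 i : 0 <= m i.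
  by rewrite -lee_fin -fm; apply: integral_ge0 => w _; rewrite lee_fin.
(* The last factor is integrated while the others are still indicators. This makes [Z * f n (X n)],
   with constant [c * m n], an admissible weight for the induction hypothesis. *)
have step (A : nat -> set S) : (forall i, measurable (A i)) ->
    (\int[P]_w (Z w * \prod_(i < n) \1_(A i) (X i w) * f n (X n w))%:E =
     (c * \prod_(i < n) fine (P (X i @^-1` A i)) * m n)%:E)%E.
  move=> mA; apply: integral_mul_indep => //.
  - apply: measurable_funM => //; apply: measurable_prod => i _.
    exact: measurable_indic_comp.
  - by move=> w; rewrite mulr_ge0// prodr_ge0.
  - by rewrite mulr_ge0// prodr_ge0// => i _; rewrite fine_ge0.
  (* Putting [B] in the last place turns the hypothesis on [n.+1] sets into the one on the last
     variable alone. *)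
  - move=> B mB; pose A' i := if (i == n)%N then B else A i.
    have mA' i : measurable (A' i) by rewrite /A'; case: ifP.
    have A'E (i : 'I_n) : A' i = A i by rewrite /A' ltn_eqF.
    have A'n : A' n = B by rewrite /A' eqxx.
    have := ZA A' mA'.
    rewrite big_ord_recr/= A'n mulrA.
    under [in RHS]eq_bigr do rewrite A'E.
    move=> <-; apply: eq_integral => w _.
    rewrite big_ord_recr/= A'n mulrA.
    by under [in RHS]eq_bigr do rewrite A'E.
have Zn : (\int[P]_w (Z w * f n (X n w))%:E = (c * m n)%:E)%E.
  have := step (fun=> setT) (fun=> measurableT).
  rewrite [in RHS]big1 ?mulr1; last first.
    by move=> i _; rewrite preimage_setT probability_setT.
  move=> <-; apply: eq_integral => w _.
  by rewrite big1 ?mulr1// => i _; rewrite indicT.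
rewrite big_ord_recr/= mulrA mulrAC -(IH X (fun w => Z w * f n (X n w)) _ f)//.
- by apply: eq_integral => w _; rewrite big_ord_recr/= mulrA mulrAC.
- exact: measurable_funM.
- by move=> w; rewrite mulr_ge0.
- by rewrite mulr_ge0.
- move=> A mA; rewrite mulrAC -step//.
  by apply: eq_integral => w _; rewrite mulrAC.
Qed.

End independence_product.

(** * Transforms of the exponential and Poisson laws *)

Section laplace_transforms.
Context d (T : measurableType d) (R : realType) (P : probability T R).

(** The density of rate 1 times [expR (- s * x)] is [(1 + s)^-1] times the density of rate [1 + s],
    whose total mass is 1. *)
Lemma integral_exponential_laplace (X : {RV P >-> R}) (s : R) : 0 <= s ->
  (forall A, measurable A -> distribution P X A = exponential_prob 1 A) ->
  (\int[P]_w (expR (- s * X w))%:E = ((1 + s)^-1)%:E)%E.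
Proof.
move=> s0 XE.
have mexp : measurable_fun [set: R] (fun x : R => expR (- s * x)).
  by apply: measurableT_comp => //; exact: measurable_funM.
have s1 : 0 < 1 + s by rewrite ltr_wpDr.
transitivity (\int[lebesgue_measure]_x
    (exponential_pdf 1 x * expR (- s * x))%:E)%E.
  have <- : (1%:E * \int[distribution P X]_x (expR (- s * x))%:E =
      \int[P]_w (expR (- s * X w))%:E)%E.
    rewrite mul1e (ge0_integral_distribution X
      (f := fun x : R => (expR (- s * x))%:E))//.
    exact/measurable_EFinP.
  apply/esym; apply: (@ge0_integral_transfer _ _ _ _ _ lebesgue_measure
      (distribution P X) id (exponential_pdf 1)) => //.
  - exact: measurable_exponential_pdf.
  - by move=> x; exact: exponential_pdf_ge0.
  - move=> A mA; rewrite mul1e -[RHS]/(distribution P X A) XE//.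
    rewrite /exponential_prob [RHS]integral_mkcond.
    apply: eq_integral => x _; rewrite patchE indicE.
    by case: ifPn => /= _; rewrite ?mulr1 ?mulr0.
transitivity (\int[lebesgue_measure]_x
    (((1 + s)^-1)%:E * (exponential_pdf (1 + s) x)%:E))%E.
  apply: eq_integral => x _; rewrite -EFinM; congr EFin.
  have [x0|x0] := leP 0 x; last by rewrite !lt0_exponential_pdf// mul0r mulr0.
  rewrite !exponential_pdfE// mul1r mulrA mulVf ?gt_eqF// mul1r -expRD.
  by congr expR; ring.
rewrite ge0_integralZl//=.
- by rewrite integral_exponential_pdf// mule1.
- by apply/measurable_EFinP; exact: measurable_exponential_pdf.
- by move=> x _; rewrite lee_fin exponential_pdf_ge0// ltW.
- by rewrite lee_fin invr_ge0 ltW.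
Qed.

Lemma integral_poisson_pmf_indic (r : R) (A : set nat) : 0 < r ->
  (\int[counting]_k (poisson_pmf r k * \1_A k)%:E = poisson_prob r 0%N A)%E.
Proof.
move=> r0; rewrite ge0_integral_count; last first.
  by move=> k; rewrite lee_fin mulr_ge0// poisson_pmf_ge0.
rewrite /poisson_prob r0 nneseries_esumT; last first.
  by move=> k; rewrite lee_fin mulr_ge0// poisson_pmf_ge0.
rewrite [RHS]esum_mkcond; apply: eq_esum => k _; rewrite indicE.
by case: ifPn; rewrite ?mulr1 ?mulr0.
Qed.

(** The Poisson weights of mean [r] times [c ^+ k] are [expR (- (r * (1 - c)))] times those of mean
    [r * c], which sum to 1. *)
Lemma integral_poisson_pgf (K : {RV P >-> nat}) (r c : R) : 0 <= r -> 0 < c ->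
  (forall A : set nat, P (K @^-1` A) = poisson_prob r 0%N A) ->
  (\int[P]_w (c ^+ K w)%:E = (expR (- (r * (1 - c))))%:E)%E.
Proof.
move=> r0 c0 KE.
rewrite -(ge0_integral_distribution K (f := fun k => (c ^+ k)%:E))//; last first.
  by move=> k; rewrite lee_fin exprn_ge0// ltW.
(* At [r = 0] the law is defined separately, as the Dirac measure at 0. *)
move: r0; rewrite le_eqVlt => /predU1P[r0|r0].
  rewrite (eq_measure_integral (dirac 0%N)); last first.
    by move=> A _ _; rewrite /= /distribution /pushforward KE /poisson_prob -r0 ltxx.
  by rewrite integral_dirac// diracT mul1e expr0 -r0 mul0r oppr0 expR0.
transitivity (\int[counting]_k (poisson_pmf r k * c ^+ k)%:E)%E.
  rewrite -[LHS]mul1e; apply/esym.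
  apply: (@ge0_integral_transfer _ _ _ _ _ counting (distribution P K)
    id (poisson_pmf r)) => //.
  - by move=> k; exact: poisson_pmf_ge0.
  - by move=> A _; rewrite mul1e integral_poisson_pmf_indic// -KE.
  - by move=> k; rewrite exprn_ge0// ltW.
transitivity (\int[counting]_k
    ((expR (- (r * (1 - c))))%:E * (poisson_pmf (r * c) k * \1_[set: nat] k)%:E))%E.
  apply: eq_integral => k _; rewrite -EFinM indicT mulr1; congr EFin.
  rewrite /poisson_pmf r0 mulr_gt0// exprMn.
  rewrite (_ : - r = - (r * (1 - c)) + - (r * c)); last by ring.
  by rewrite expRD; ring.
rewrite ge0_integralZl//=; last first.
  by move=> k _; rewrite lee_fin mulr_ge0// poisson_pmf_ge0.
by rewrite integral_poisson_pmf_indic ?mulr_gt0// probability_setT mule1.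
Qed.

End laplace_transforms.

(** * Randomly indexed families *)

Lemma big_iota_ord (A : Type) (idx : A) (op : A -> A -> A) n (G : nat -> A) :
  \big[op/idx]_(i <- iota 0 n) G i = \big[op/idx]_(i < n) G i.
Proof. by rewrite -[in LHS](subn0 n) big_mkord. Qed.

Section random_index.
Context d (T : measurableType d) (R : realType).
Variables (N : T -> nat) (mN : measurable_fun setT N).

Let mNn n : measurable (N @^-1` [set n]).
Proof. by rewrite -[X in measurable X]setTI; exact: mN. Qed.

Let NnT : \bigcup_n N @^-1` [set n] = setT.
Proof. by apply/seteqP; split=> // w _; exists (N w). Qed.

Lemma measurable_random_index d' (S : measurableType d') (G : nat -> T -> S) :
  (forall n, measurable_fun setT (G n)) ->
  measurable_fun setT (fun w => G (N w) w).
Proof.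
move=> mG; rewrite -NnT; apply/measurable_fun_bigcup => // n.
apply: (eq_measurable_fun (G n)) => [w|].
  by rewrite inE => /= ->.
exact: measurable_funTS.
Qed.

(** The fibers of [N] form a countable partition, so an integral with a random index is a series of
    integrals with a fixed one. *)
Lemma eq_integral_random_index (mu : {measure set T -> \bar R})
    (G H : nat -> T -> R) :
  (forall n, measurable_fun setT (G n)) -> (forall n, measurable_fun setT (H n)) ->
  (forall n w, 0 <= G n w) -> (forall n w, 0 <= H n w) ->
  (forall n, \int[mu]_(w in N @^-1` [set n]) (G n w)%:E =
             \int[mu]_(w in N @^-1` [set n]) (H n w)%:E)%E ->
  (\int[mu]_w (G (N w) w)%:E = \int[mu]_w (H (N w) w)%:E)%E.
Proof.
have fiberE (K : nat -> T -> R) : measurable_fun setT (fun w => K (N w) w) ->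
    (forall n w, 0 <= K n w) ->
    (\int[mu]_w (K (N w) w)%:E =
     \sum_(n <oo) \int[mu]_(w in N @^-1` [set n]) (K n w)%:E)%E.
  move=> mK K0; rewrite -NnT ge0_integral_bigcup//.
  - apply: eq_eseriesr => n _; apply: eq_integral => w.
    by rewrite inE => /= ->.
  - by rewrite NnT; exact/measurable_EFinP.
  - by move=> w _; rewrite lee_fin.
  - apply/trivIsetP => i j _ _ ij; apply/seteqP; split=> // w [/= Ni Nj].
    by move: ij; rewrite -Ni -Nj eqxx.
move=> mG mH G0 H0 GH.
rewrite !fiberE//.
- by apply: eq_eseriesr => n _.
- exact: measurable_random_index.
- exact: measurable_random_index.
Qed.

End random_index.

(** * Independence along finite sequences *)

Section independence_seq.
Context d d' (T : measurableType d) (S : measurableType d') (R : realType).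
Variable P : probability T R.

Lemma prod_indic (I : eqType) (s : seq I) (A : I -> set S) (X : I -> T -> S) w :
  \prod_(i <- s) \1_(A i) (X i w) =
  \1_(\bigcap_(i in [set` s]) X i @^-1` A i) w :> R.
Proof.
elim: s => [|i s IH].
  by rewrite big_nil (_ : bigcap _ _ = setT) ?indicT//; apply/seteqP; split.
rewrite big_cons IH (_ : \bigcap_(j in [set` i :: s]) _ =
    X i @^-1` A i `&` \bigcap_(i in [set` s]) X i @^-1` A i).
  by rewrite indicI /= !indicE; congr ((nat_of_bool _)%:R * _).
apply/seteqP; split=> [x h|x [h1 h2] j].
  by split=> [|j js]; apply: h; rewrite /= inE ?eqxx//= js orbT.
by rewrite /= inE => /predU1P[->//|js]; exact: h2.
Qed.

(** Independence is defined over finite sets; a sequence without repetition is a permutation of the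
    enumeration of its set of elements. *)
Lemma mutually_independent_seq (I : choiceType) (X : I -> T -> S) (s : seq I)
    (A : I -> set S) :
  mutually_independent P X -> uniq s -> (forall i, measurable (A i)) ->
  P (\bigcap_(i in [set` s]) X i @^-1` A i) = (\prod_(i <- s) P (X i @^-1` A i))%E.
Proof.
move=> indX us mA; have := indX [fset i | i in s]%fset A mA.
rewrite (_ : [set` [fset i | i in s]%fset] = [set` s]); last first.
  by apply/seteqP; split=> i /=; rewrite !inE.
move=> ->; apply: perm_big; apply: uniq_perm => // i.
by rewrite !inE.
Qed.

End independence_seq.

(** * Averaging over the marks *)

(** An assignment of n points to J cells, extended by 0 to all of [nat], the index type of the
    families of cells and weights. *)
Definition ffun_nat n J (t : {ffun 'I_n -> 'I_J}) (i : nat) : nat :=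
  if insub i is Some k then t k else 0%N.

Lemma ffun_natE n J (t : {ffun 'I_n -> 'I_J}) (i : 'I_n) : ffun_nat t i = t i.
Proof.
by rewrite /ffun_nat insubT//= => ltin; congr (nat_of_ord (t _)); exact: val_inj.
Qed.

Section simple_path_loss.
Context d (T : measurableType d) (R : realType) (P : probability T R).
Variables (N : {RV P >-> nat}) (Y F : nat -> {RV P >-> R}).
Hypothesis marksF : iid_exponential_marks N Y F.

Definition cell (B : nat -> set R) n (tau : nat -> nat) : set T :=
  N @^-1` [set n] `&` \bigcap_(i in [set` iota 0 n]) Y i @^-1` B (tau i).

Lemma measurable_cell B n tau : (forall j, measurable (B j)) ->
  measurable (cell B n tau).
Proof.
move=> mB; apply: measurableI; first exact: measurable_funPTI.
by apply: bigcap_measurableType => i _; exact: measurable_funPTI.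
Qed.

(** A cell event belongs to the sigma-algebra generated by the number and the locations of the
    points, from which the marks are independent. *)
Lemma cell_marks_indep B n tau (A : nat -> set R) :
  (forall j, measurable (B j)) -> (forall i, measurable (A i)) ->
  P (cell B n tau `&` \bigcap_(i in [set` iota 0 n]) F i @^-1` A i) =
  (P (cell B n tau) * P (\bigcap_(i in [set` iota 0 n]) F i @^-1` A i))%E.
Proof.
move=> mB mA; case: marksF => _ _ indFY.
rewrite setIC indFY; first by rewrite muleC.
- rewrite /sigma_family.
  (* Membership in the generated sigma-algebra is read as measurability in [g_sigma_algebraType G],
     which gives closure under intersections. *)
  set G := \bigcup_i _.
  apply: (@bigcap_measurableType _ (g_sigma_algebraType G)) => i _.
  apply: sub_sigma_algebra; exists i => //; exists (A i) => //.
  by rewrite setTI.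
- set G := _ `|` _.
  apply: (@measurableI _ (g_sigma_algebraType G)).
    by apply: sub_sigma_algebra; left; exists [set n] => //; rewrite setTI.
  apply: (@bigcap_measurableType _ (g_sigma_algebraType G)) => i _.
  apply: sub_sigma_algebra; right.
  apply: sub_sigma_algebra; exists i => //; exists (B (tau i)) => //.
  by rewrite setTI.
Qed.

(** On a fixed cell event the weights [a i] are deterministic. The marks, independent of the event
    and of each other, are integrated one by one, with the indicator of the event as the weight in
    [integral_prod_indep]. *)
Lemma integral_cell_marks B n tau (a : nat -> R) :
  (forall j, measurable (B j)) -> (forall i, 0 <= a i) ->
  (\int[P]_w (\1_(cell B n tau) w * \prod_(i < n) expR (- a i * F i w))%:E =
   \int[P]_w (\1_(cell B n tau) w * \prod_(i < n) (1 + a i)^-1)%:E)%E.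
Proof.
move=> mB a0; case: marksF => lawF indF _.
have mC := measurable_cell n tau mB.
have PC : P (cell B n tau) = (fine (P (cell B n tau)))%:E.
  by rewrite fineK// fin_num_measure.
rewrite (integral_prod_indep (c := fine (P (cell B n tau)))
  (f := fun i x => expR (- a i * x)) (m := fun i => (1 + a i)^-1))//.
- under [RHS]eq_integral do rewrite EFinM.
  rewrite ge0_integralZr//.
  + by rewrite integral_indic// setIT EFinM -PC.
  + by apply/measurable_EFinP; exact: measurable_indic.
  + by rewrite lee_fin prodr_ge0// => i _; rewrite invr_ge0 addr_ge0.
- by rewrite fine_ge0.
- by move=> i; apply: measurableT_comp.
- by move=> i; exact: (integral_exponential_laplace (a0 i) (lawF i)).
- move=> A mA.
  transitivity (P (cell B n tau `&` \bigcap_(i in [set` iota 0 n]) F i @^-1` A i)).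
    rewrite -[X in P X]setIT -integral_indic//.
      apply: eq_integral => w _; congr EFin.
      rewrite indicI/= -prod_indic; congr (_ * _).
      by rewrite big_iota_ord.
    apply: measurableI => //; apply: bigcap_measurableType => i _.
    exact: measurable_funPTI.
  rewrite cell_marks_indep// mutually_independent_seq ?iota_uniq// EFinM -PC.
  congr (_ * _)%E; rewrite -prodEFin big_iota_ord.
  apply: eq_bigr => i _; rewrite fineK// fin_num_measure//; exact: measurable_funPTI.
Qed.

(** Distributing the product over the sums yields one term for each assignment of points to cells;
    the indicators in that term multiply to that of a cell event. *)
Lemma integral_prod_cells (B : nat -> set R) J n (v : nat -> nat -> T -> R) :
  (forall j, measurable (B j)) -> (forall i j, measurable_fun setT (v i j)) ->
  (forall i j w, 0 <= v i j w) ->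
  (\int[P]_(w in N @^-1` [set n])
     (\prod_(i < n) \sum_(j < J) \1_(B j) (Y i w) * v i j w)%:E =
   \sum_(t : {ffun 'I_n -> 'I_J}) \int[P]_w
     (\1_(cell B n (ffun_nat t)) w * \prod_(i < n) v i (ffun_nat t i) w)%:E)%E.
Proof.
move=> mB mv v0; rewrite -ge0_integral_sum//; last 2 first.
- move=> t; apply/measurable_EFinP; apply: measurable_funM.
    by apply: measurable_indic; exact: measurable_cell.
  exact: measurable_prod.
- by move=> t w _; rewrite lee_fin mulr_ge0// prodr_ge0.
rewrite [LHS]integral_mkcond; apply: eq_integral => w _.
rewrite epatch_indic/= -EFinM sumEFin; congr EFin.
rewrite bigA_distr_bigA/= mulr_suml; apply: eq_bigr => t _.
rewrite big_split/= mulrAC; congr (_ * _); last first.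
  by apply: eq_bigr => i _; rewrite ffun_natE.
rewrite /cell indicI/= mulrC; congr (_ * _).
rewrite -prod_indic big_iota_ord.
by apply: eq_bigr => i _; rewrite ffun_natE.
Qed.

(** The marks are averaged out for each number of points and each assignment to cells separately,
    then the terms are reassembled. *)
Lemma integral_marks (B : nat -> set R) J (a : nat -> R) :
  (forall j, measurable (B j)) -> (forall i, 0 <= a i) ->
  (\int[P]_w (\prod_(i < N w) \sum_(j < J)
      \1_(B j) (Y i w) * expR (- a j * F i w))%:E =
   \int[P]_w (\prod_(i < N w) \sum_(j < J)
      \1_(B j) (Y i w) * (1 + a j)^-1)%:E)%E.
Proof.
move=> mB a0.
have mexp i j : measurable_fun setT (fun w => expR (- a j * F i w)).
  by apply: measurableT_comp => //; exact: measurable_funM.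
have sum0 (i : nat) (u : nat -> R) w : (forall j, 0 <= u j) ->
    0 <= \sum_(j < J) \1_(B j) (Y i w) * u j.
  by move=> u0; apply: sumr_ge0 => j _; rewrite mulr_ge0.
have c0 i : 0 <= (1 + a i)^-1 by rewrite invr_ge0 addr_ge0.
apply: (@eq_integral_random_index _ _ _ N _ P
  (fun n w => \prod_(i < n) \sum_(j < J) \1_(B j) (Y i w) * expR (- a j * F i w))
  (fun n w => \prod_(i < n) \sum_(j < J) \1_(B j) (Y i w) * (1 + a j)^-1)) => //.
- move=> n; apply: measurable_prod => i _; apply: measurable_sum => j.
  by apply: measurable_funM => //; exact: measurable_indic_comp.
- move=> n; apply: measurable_prod => i _; apply: measurable_sum => j.
  by apply: measurable_funM => //; exact: measurable_indic_comp.
- move=> n w; apply: prodr_ge0 => i _.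
  by apply: (sum0 i (fun j => expR (- a j * F i w))) => j; exact: expR_ge0.
- by move=> n w; apply: prodr_ge0 => i _; exact: (sum0 i (fun j => (1 + a j)^-1)).
- move=> n.
  rewrite (integral_prod_cells J n (v := fun i j w => expR (- a j * F i w)))//.
  rewrite (integral_prod_cells J n (v := fun i j w => (1 + a j)^-1))//.
  by apply: eq_bigr => t _; apply: (integral_cell_marks n (ffun_nat t)
    (a := fun i => a (ffun_nat t i))).
Qed.

End simple_path_loss.

(** * The Laplace functional of the marked Poisson process *)

Section laplace_simple.
Context d (T : measurableType d) (R : realType) (P : probability T R).
Variables (N : {RV P >-> nat}) (Y : nat -> {RV P >-> R}).
Variables (lam : R) (D : set R).
Hypothesis poissonNY : homogeneous_poisson_process lam D N Y.
Hypothesis lam_ge0 : 0 <= lam.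

Lemma measurable_point_count B : measurable B ->
  measurable_fun setT (point_count N Y B).
Proof.
move=> mB; rewrite /point_count.
apply: (@measurable_random_index _ _ N _ _ _
  (fun n w => \sum_(i < n) (Y i w \in B))%N) => // n.
elim: n => [|n IH].
  by rewrite (_ : (fun _ => _) = cst 0%N)//; apply/funext => w; rewrite big_ord0.
under eq_fun do rewrite big_ord_recr/=.
apply: measurable_fun_addn => // _ A _; rewrite setTI.
rewrite (_ : _ @^-1` A = (if 1%N \in A then Y n @^-1` B else set0) `|`
                         (if 0%N \in A then ~` (Y n @^-1` B) else set0)); last first.
  apply/seteqP; split=> [w /=|w].
    have [YB|YB] := boolP (Y n w \in B) => A1.
      by left; rewrite mem_set//; exact: set_mem.
    by right; rewrite mem_set//= => /mem_set; exact: negP.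
  move=> []; case: ifPn => // /set_mem A1 /= YB.
    by rewrite mem_set.
  by rewrite memNset.
have mYB : measurable (Y n @^-1` B) by exact: measurable_funPTI.
by apply: measurableU; case: ifP => // _; exact: measurableC.
Qed.

Definition point_count_rv B (mB : measurable B) : {RV P >-> nat} :=
  mfun_Sub (mem_set (measurable_point_count mB)).

Variables (B : nat -> set R) (J : nat).
Hypothesis mB : forall j, measurable (B j).
Hypothesis BD : forall j, B j `<=` D.
Hypothesis tB : trivIset setT (fun j : 'I_J => B j).
Hypothesis DB : forall y, D y -> exists j : 'I_J, B j y.

(** Every point lies in exactly one cell, so its factor is a single [c j], and grouping the points
    by cell produces the powers. *)
Lemma prod_points_counts (c : nat -> R) w :
  \prod_(i < N w) \sum_(j < J) \1_(B j) (Y i w) * c j =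
  \prod_(j < J) c j ^+ point_count N Y (B j) w.
Proof.
case: poissonNY => YD _ _.
(* A count is a sum of indicators over the points, so each power splits into a product over the
   points. *)
under [RHS]eq_bigr do rewrite /point_count -prodrXr.
rewrite exchange_big/=; apply: eq_bigr => i _.
have [j0 Bj0] := DB (YD w i (ltn_ord i)).
have notB j : j != j0 -> (Y i w \in B j) = false.
  move=> jj0; apply/negP => /set_mem Bj; move/eqP: jj0; apply.
  by apply: tB => //; exists (Y i w).
rewrite (bigD1 j0)//= big1 ?addr0; last first.
  by move=> j /notB jB; rewrite indicE jB mul0r.
rewrite (bigD1 j0)//= big1 ?mulr1; last by move=> j /notB ->.
by rewrite indicE mem_set// mul1r.
Qed.

(** Counts in disjoint cells are independent Poisson variables, and each factor is a probability
    generating function evaluated at [c j]. *)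
Lemma integral_prod_counts (c : nat -> R) : (forall j, 0 < c j) ->
  (\int[P]_w (\prod_(j < J) c j ^+ point_count N Y (B j) w)%:E =
  (\prod_(j < J)
     expR (- (lam * fine (lebesgue_measure (B j)) * (1 - c j))))%:E)%E.
Proof.
case: poissonNY => _ lawY indY c0.
pose K j := point_count_rv (mB j).
pose m j := expR (- (lam * fine (lebesgue_measure (B j)) * (1 - c j))).
rewrite -[in RHS](mul1r (\prod_(_ < _) _)).
rewrite -(@integral_prod_indep _ _ _ _ _ P J K (cst 1) 1 (fun j k => c j ^+ k) m)//.
- by apply: eq_integral => w _; rewrite mul1r.
- by move=> j k; rewrite exprn_ge0// ltW.
- move=> j; apply: integral_poisson_pgf => //.
    by rewrite mulr_ge0// fine_ge0.
  by move=> A; exact: lawY.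
- move=> A mA; rewrite mul1r.
  under eq_integral do rewrite mul1r.
  have mKA j : measurable (K j @^-1` A j).
    exact: measurable_funPTI.
  transitivity (P (\bigcap_(j in [set` index_enum 'I_J])
      (fun i : 'I_J => K i : T -> nat) j @^-1` A j)).
    rewrite -[X in P X]setIT -integral_indic//.
      by apply: eq_integral => w _; rewrite -prod_indic.
    by apply: fin_bigcap_measurable => [|j _]; [exact: finite_seq|exact: mKA].
  rewrite (mutually_independent_seq (A := fun i : 'I_J => A i))//.
  + rewrite -prodEFin; apply: eq_bigr => j _.
    by rewrite fineK// fin_num_measure.
  + by apply: (indY J (fun j => B j)) => // j; split.
  + exact: index_enum_uniq.
Qed.

End laplace_simple.

(** On nonnegative reals the inverse is the power of exponent -1, and powers are measurable. *)
Lemma measurable_inv1D d (T : measurableType d) (R : realType) (D : set T)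
    (f : T -> R) :
  measurable_fun D f -> (forall x, 0 <= f x) ->
  measurable_fun D (fun x => (1 + f x)^-1).
Proof.
move=> mf f0; rewrite (_ : (fun _ => _) = (@powR R ^~ (-1)) \o (fun x => 1 + f x)).
  apply: measurableT_comp; first exact: measurable_powR.
  exact: measurable_funD.
by apply/funext => x /=; rewrite powR_inv1// addr_ge0.
Qed.

(** * From simple functions to arbitrary nonnegative path losses *)

Section poisson_laplace.
Context d (T : measurableType d) (R : realType) (P : probability T R).
Variables (N : {RV P >-> nat}) (Y F : nat -> {RV P >-> R}).
Variables (lam : R) (D : set R).
Hypothesis poissonNY : homogeneous_poisson_process lam D N Y.
Hypothesis marksF : iid_exponential_marks N Y F.
Hypothesis lam_ge0 : 0 <= lam.
Hypothesis mD : measurable D.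
Hypothesis D_fin : (lebesgue_measure D < +oo)%E.

Import HBNNSimple.

Lemma laplace_functional_nnsfun (h : {nnsfun R >-> R}) :
  (\int[P]_w (expR (- \sum_(i < N w) F i w * h (Y i w)))%:E =
   (expR (- lam * fine (\int[lebesgue_measure]_(y in D)
      (1 - (1 + h y)^-1)%:E)))%:E)%E.
Proof.
pose s := enum_fset (fset_set (range h)); pose J := size s.
(* The values of [h]; the default 0 keeps [a j] nonnegative for every j, as [integral_marks]
   requires. *)
pose a j := nth 0 s j.
(* The level sets of [h] partition [D]. *)
pose B j : set R := if (j < J)%N then D `&` h @^-1` [set a j] else set0.
have hs y : h y \in s by rewrite in_fset_set// inE; exists y.
have us : uniq s by exact: fset_uniq.
have a0 j : 0 <= a j.
  have [jJ|jJ] := ltnP j J; last by rewrite /a nth_default.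
  have : a j \in s by exact: mem_nth.
  by rewrite in_fset_set// inE => -[y _ <-].
have mB j : measurable (B j) by rewrite /B; case: ifP => // _; exact: measurableI.
have BD j : B j `<=` D by rewrite /B; case: ifP => // _ y [].
have BE (j : 'I_J) : B j = D `&` h @^-1` [set a j] by rewrite /B ltn_ord.
have tB : trivIset setT (fun j : 'I_J => B j).
  move=> i j _ _ [y []]; rewrite !BE => -[_ /= hi] [_ /= hj].
  apply/val_inj/eqP; rewrite -(nth_uniq 0 (ltn_ord i) (ltn_ord j) us).
  by apply/eqP; exact: etrans (esym hi) hj.
have DB y : D y -> exists j : 'I_J, B j y.
  move=> Dy; have hJ : (index (h y) s < J)%N by rewrite index_mem.
  by exists (Ordinal hJ); rewrite BE; split=> //=; rewrite /a nth_index.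
pose c j := (1 + a j)^-1.
have c0 j : 0 < c j by rewrite invr_gt0 ltr_wpDr.
have c1 j : 0 <= 1 - c j by rewrite subr_ge0 invf_le1 ?lerDl// ltr_wpDr.
case: (poissonNY) => YD _ _.
(* For each point only the term of its own cell survives in the inner sum, and there [h] equals
   [a j]. *)
transitivity (\int[P]_w (\prod_(i < N w) \sum_(j < J)
      \1_(B j) (Y i w) * expR (- a j * F i w))%:E)%E.
  apply: eq_integral => w _; rewrite -sumrN expR_sum; congr EFin.
  apply: eq_bigr => i _; have Dy := YD w i (ltn_ord i).
  have [j0 Bj0] := DB _ Dy.
  rewrite (bigD1 j0)//= big1 ?addr0; last first.
    move=> j jj0; rewrite indicE memNset ?mul0r// => Bj; move/eqP: jj0; apply.
    by apply: tB => //; exists (Y i w).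
  rewrite indicE mem_set// mul1r; congr expR.
  by move: Bj0; rewrite BE => -[_ /= ->]; ring.
rewrite (integral_marks marksF J mB a0).
transitivity (\int[P]_w (\prod_(j < J) c j ^+ point_count N Y (B j) w)%:E)%E.
  by apply: eq_integral => w _; rewrite (prod_points_counts poissonNY tB DB c).
rewrite (integral_prod_counts poissonNY lam_ge0 mB BD tB c0).
rewrite -expR_sum; congr ((expR _)%:E).
have DE : D = \big[setU/set0]_(j < J) B j.
  rewrite -bigcup_mkord; apply/seteqP; split=> y.
    by move=> /DB[j Bj]; exists j => /=.
  by move=> [j _]; exact: BD.
have mg : measurable_fun setT (fun y => 1 - (1 + h y)^-1 : R).
  by apply: measurable_funB => //; exact: measurable_inv1D.
(* The integrand is the constant [1 - c j] on each cell, and every cell has finite length because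
   [D] has. *)
have -> : (\int[lebesgue_measure]_(y in D) (1 - (1 + h y)^-1)%:E =
    (\sum_(j < J) fine (lebesgue_measure (B j)) * (1 - c j))%:E)%E.
  rewrite [in LHS]DE ge0_integral_bigsetU//.
  - rewrite -sumEFin; apply: eq_bigr => j _.
    transitivity (\int[lebesgue_measure]_(y in B j) (1 - c j)%:E)%E.
      by apply: eq_integral => y; rewrite inE BE => -[_ /= ->].
    rewrite integral_cst; last exact: mB.
    rewrite muleC EFinM fineK// ge0_fin_numE//.
    apply: le_lt_trans D_fin.
    by apply: le_measure => //; rewrite inE; [exact: mB|exact: mD].
  - by move=> j; exact: mB.
  - exact: index_enum_uniq.
  - by apply: sub_trivIset tB.
  - exact/measurable_EFinP/measurable_funTS.
  - by move=> y _; rewrite lee_fin subr_ge0 invf_le1 ?lerDl// ltr_wpDr.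
rewrite /= mulr_sumr; apply: eq_bigr => j _; ring.
Qed.

(** The exponential density vanishes on the negative half-line. The law controls the marks only up
    to a null event, hence the almost sure form, which suffices for domination. *)
Lemma ae_marks_ge0 : {ae P, forall w, forall i, 0 <= F i w}.
Proof.
apply: ae_foralln => i; case: marksF => lawF _ _.
exists (F i @^-1` `]-oo, 0[); split.
- exact: measurable_funPTI.
- rewrite -[LHS]/(distribution P (F i) `]-oo, 0[) lawF// /exponential_prob.
  apply: integral0_eq => x /=; rewrite in_itv/= => x0.
  by rewrite lt0_exponential_pdf.
- by move=> w /= /negP; rewrite -ltNge in_itv.
Qed.

(** Both sides are limits of their values at simple functions increasing to [l]. Dominated
    convergence applies with the bound 1, under [P] and on the set [D] of finite length. *)
Lemma laplace_functional (l : R -> R) :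
  measurable_fun setT l -> (forall y, 0 <= l y) ->
  (\int[P]_w (expR (- \sum_(i < N w) F i w * l (Y i w)))%:E =
   (expR (- lam * fine (\int[lebesgue_measure]_(y in D)
      (1 - (1 + l y)^-1)%:E)))%:E)%E.
Proof.
move=> ml l0.
have mEl : measurable_fun setT (EFin \o l) by exact/measurable_EFinP.
pose h := nnsfun_approx measurableT mEl.
have hl y : h n y @[n --> \oo] --> l y.
  have l0E z : [set: R] z -> (0 <= (EFin \o l) z)%E by rewrite lee_fin.
  by have /fine_cvgP[_] := cvg_nnsfun_approx measurableT mEl l0E (x := y) Logic.I.
have mexp (f : R -> R) : measurable_fun setT f ->
    measurable_fun setT (fun w => expR (- \sum_(i < N w) F i w * f (Y i w))).
  move=> mf; apply: (@measurable_random_index _ _ N _ _ _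
    (fun n w => expR (- \sum_(i < n) F i w * f (Y i w)))) => // n.
  apply: measurableT_comp => //; apply: measurable_funN.
  apply: measurable_sum => i; apply: measurable_funM => //.
  exact: measurableT_comp.
have L : (\int[P]_w (expR (- \sum_(i < N w) F i w * h n (Y i w)))%:E
    @[n --> \oo] --> \int[P]_w (expR (- \sum_(i < N w) F i w * l (Y i w)))%:E)%E.
  have [] := @dominated_convergence _ _ _ P setT measurableT
    (fun n w => (expR (- \sum_(i < N w) F i w * h n (Y i w)))%:E)
    (fun w => (expR (- \sum_(i < N w) F i w * l (Y i w)))%:E) (cst 1%E).
  - by move=> n; apply/measurable_EFinP; exact: mexp.
  - by apply/measurable_EFinP; exact: mexp.
  - apply: aeW => w _; apply: cvg_EFin; first exact: nearW.
    apply: continuous_cvg; first exact: continuous_expR.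
    apply: cvgN; apply: cvg_big => [|i _]; first exact: add_continuous.
    by apply: cvgMl_tmp; exact: hl.
  - exact: finite_measure_integrable_cst.
  (* With nonnegative marks the exponent is at most 0, so the exponential is at most 1. *)
  - apply: filterS ae_marks_ge0 => w F0 n _.
    rewrite lee_fin ger0_norm ?expR_ge0// expR_le1 oppr_le0.
    by apply: sumr_ge0 => i _; rewrite mulr_ge0.
  - by [].
have g01 (f : R -> R) y : (forall y, 0 <= f y) -> 0 <= 1 - (1 + f y)^-1 <= 1.
  move=> f0; rewrite subr_ge0 invf_le1 ?lerDl ?ltr_wpDr//= f0/=.
  by rewrite gerBl invr_ge0 addr_ge0.
have mg (f : R -> R) : measurable_fun setT f -> (forall y, 0 <= f y) ->
    measurable_fun D (fun y => (1 - (1 + f y)^-1)%:E).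
  move=> mf f0; apply: measurable_funTS; apply/measurable_EFinP.
  by apply: measurable_funB => //; exact: measurable_inv1D.
have K : (\int[lebesgue_measure]_(y in D) (1 - (1 + h n y)^-1)%:E
    @[n --> \oo] --> \int[lebesgue_measure]_(y in D) (1 - (1 + l y)^-1)%:E)%E.
  have [] := @dominated_convergence _ _ _ lebesgue_measure D mD
    (fun n y => (1 - (1 + h n y)^-1)%:E)
    (fun y => (1 - (1 + l y)^-1)%:E) (cst 1%E).
  - by move=> n; exact: mg.
  - exact: mg.
  - apply: aeW => y _; apply: cvg_EFin; first exact: nearW.
    apply: cvgB; first exact: cvg_cst.
    apply: cvgV; first by rewrite gt_eqF// ltr_wpDr.
    by apply: cvgD; [exact: cvg_cst|exact: hl].
  - apply/integrableP; split; first exact: measurable_cst.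
    by under eq_integral do rewrite /= normr1; rewrite integral_cst// mul1e.
  - apply: aeW => y n _; have /andP[h0 h1] := g01 (h n) y (fun_ge0 (s := h n)).
    by rewrite lee_fin ger0_norm.
  - by [].
(* A finite limit is what allows [fine] to be exchanged with the limit below. *)
have fin_int : (\int[lebesgue_measure]_(y in D) (1 - (1 + l y)^-1)%:E)%E \is a fin_num.
  rewrite ge0_fin_numE; last first.
    by apply: integral_ge0 => y _; rewrite lee_fin; have /andP[] := g01 l y l0.
  apply: le_lt_trans D_fin; rewrite -[leRHS]mul1e -integral_cst//.
  apply: ge0_le_integral => //.
  - by move=> y _; rewrite lee_fin; have /andP[] := g01 l y l0.
  - exact: mg.
  - by move=> y _; rewrite lee_fin; have /andP[] := g01 l y l0.
rewrite (_ : (fun n => \int[P]_w _)%E = (fun n => (expR (- lam *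
    fine (\int[lebesgue_measure]_(y in D) (1 - (1 + h n y)^-1)%:E)%E))%:E)) in L;
  last by apply/funext => n; exact: laplace_functional_nnsfun.
apply: (cvg_unique _ L) => //.
apply: cvg_EFin; first exact: nearW.
apply: continuous_cvg; first exact: continuous_expR.
apply: cvgMl_tmp; apply: fine_cvg.
by rewrite fineK.
Qed.

End poisson_laplace.

(** * Evaluation of the exponent *)

Section change_of_variables.
Context (R : realType).
Local Notation mu := (@lebesgue_measure R).

(** The interval is cut at 0; the reflection preserves both [f] and Lebesgue measure, and the shared
    endpoint is null. *)
Lemma ge0_integral_itv_even (f : R -> R) (r : R) : 0 <= r ->
  measurable_fun setT f -> (forall x, 0 <= f x) -> (forall x, f (- x) = f x) ->
  (\int[mu]_(x in `[(- r)%R, r]) (f x)%:E = 2%:E * \int[mu]_(x in `[0%R, r]) (f x)%:E)%E.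
Proof.
move=> r0 mf f0 fN.
have mEf (D : set R) : measurable_fun D (EFin \o f).
  by apply/measurable_EFinP; exact: measurable_funTS.
have -> : `[- r, r]%classic = `[- r, 0[ `|` `[0, r]%classic.
  apply/seteqP; split=> x /=; rewrite !in_itv/=.
    by move=> /andP[-> ->]; case: (ltP x 0) => _; [left|right].
  by case=> /andP[x1 x2]; apply/andP; split=> //; lra.
rewrite ge0_integral_setU//=; last 3 first.
- exact: mEf.
- by move=> x _; rewrite lee_fin.
- rewrite disj_set2E; apply/eqP/seteqP; split=> x //= [].
  by rewrite !in_itv/= => /andP[_ x0] /andP[]; rewrite leNgt x0.
rewrite integral_itv_bndo_bndc; last exact: (mEf `[- r, 0[%classic).
have -> : (\int[mu]_(x in `[(- r)%R, 0%R]) (f x)%:E =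
    \int[mu]_(x in `[0%R, r]) (f x)%:E)%E.
  rewrite (_ : `[- r, 0]%classic =
      (-%R : _ -> measurableTypeR R) @^-1` `[0, r]); last first.
    by rewrite opp_preimage_itvbndbnd oppr0.
  transitivity (\int[mu]_(x in (-%R : _ -> measurableTypeR R) @^-1` `[0%R, r])
      ((EFin \o f) \o -%R) x)%E.
    by apply: eq_integral => x _ /=; rewrite fN.
  rewrite -ge0_integral_pushforward//=; last 2 first.
  - exact: (mEf `[0, r]%classic).
  - by move=> x _; rewrite lee_fin.
  by apply: eq_measure_integral => //= A mA AS; exact: lebesgue_measureN.
by rewrite mule_natl mule2n.
Qed.

(* The integrand on the left is singular at delta, so u = delta + (y / zeta) ^+ 2
   is used on [r / n.+1, r] only, and n tends to infinity. *)
Lemma ge0_integral_sqrt_substitution (k : R -> R) (delta zeta r : R) :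
  0 <= delta -> 0 < zeta -> 0 < r ->
  {in `]0, +oo[, continuous k} -> measurable_fun setT k -> (forall u, 0 <= k u) ->
  (\int[mu]_(u in `[delta, ((r / zeta) ^+ 2 + delta)%R])
      ((Num.sqrt (u - delta))^-1 * k u)%:E =
   (2 / zeta)%:E * \int[mu]_(y in `[0%R, r]) (k (delta + (y / zeta) ^+ 2))%:E)%E.
Proof.
move=> delta0 zeta0 r0 ck mk k0.
pose f (y : R) : R := delta + (y / zeta) ^+ 2.
pose G u := (Num.sqrt (u - delta))^-1 * k u.
pose e n : R := r / n.+1%:R.
have e0 n : 0 < e n by rewrite divr_gt0.
have er n : e n <= r by rewrite ler_pdivrMr// ler_peMr ?ler1n// ltW.
have df (y : R) : is_derive y (1 : R) f (2 * y / zeta ^+ 2).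
  rewrite /f; apply: is_derive_eq.
  by rewrite /GRing.scale/=; field; rewrite gt_eqF.
have f'E : f^`()%classic = (fun y => 2 * y / zeta ^+ 2).
  by apply/funext => y; rewrite derive1E; exact: derive_val.
have cf' : continuous (f^`()%classic).
  rewrite f'E => y; apply: cvgMl; apply: cvgMr; exact: cvg_id.
have cf : continuous f.
  move=> y; apply: differentiable_continuous; apply/derivable1_diffP.
  by have [] := df y.
have f_lt x y : 0 <= x -> x < y -> f x < f y.
  move=> x0 xy; rewrite ltrD2l ltr_pXn2r ?nnegrE ?divr_ge0 ?(ltW zeta0)//.
    by rewrite ltr_pM2r ?invr_gt0.
  exact: le_trans (ltW xy).
have f_le x y : 0 <= x -> 0 <= y -> (f x <= f y) = (x <= y).
  move=> x0 y0; rewrite lerD2l ler_pXn2r ?nnegrE ?divr_ge0 ?(ltW zeta0)//.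
  by rewrite ler_pM2r ?invr_gt0.
have f0 y : 0 < y -> delta < f y.
  by move=> y0; rewrite ltrDl exprn_gt0// divr_gt0.
have cG u : delta < u -> {for u, continuous G}.
  move=> du; apply: cvgM.
    apply: cvgV; first by rewrite gt_eqF// sqrtr_gt0 subr_gt0.
    apply: continuous_cvg; first exact: sqrt_continuous.
    by apply: cvgB; [exact: cvg_id|exact: cvg_cst].
  by apply: ck; rewrite in_itv/= andbT (le_lt_trans delta0).
have step n : (\int[mu]_(u in `[f (e n), f r]) (G u)%:E =
    \int[mu]_(y in `[e n, r]) ((2 / zeta)%:E * (k (f y))%:E))%E.
  rewrite integration_by_substitution_increasing//.
  - apply: eq_integral => y; rewrite inE/= in_itv/= => /andP[ey yr].
    have y0 : 0 < y by exact: lt_le_trans ey.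
    rewrite f'E -EFinM; congr EFin; rewrite !fctE /= /G.
    (* The square root becomes [y / zeta]; against the derivative [2 * y / zeta ^+ 2] it leaves the
       constant [2 / zeta]. *)
    have -> : f y - delta = (y / zeta) ^+ 2 by rewrite /f; ring.
    rewrite sqrtr_sqr ger0_norm ?divr_ge0 ?ltW//.
    by field; rewrite !gt_eqF.
  - move=> x y; rewrite !in_itv/= => /andP[ex _] _; apply: f_lt.
    exact: le_trans (ltW (e0 n)) ex.
  - by apply/cvg_ex; eexists; apply: cvg_at_right_filter; exact: cf'.
  - by apply/cvg_ex; eexists; apply: cvg_at_left_filter; exact: cf'.
  - split.
    + by move=> x _; have [] := df x.
    + by apply: cvg_at_right_filter; exact: cf.
    + by apply: cvg_at_left_filter; exact: cf.
  - apply: continuous_in_subspaceT => u; rewrite inE/= in_itv/= => /andP[eu _].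
    by apply: cG; apply: lt_le_trans eu; exact: f0.
have mkf : measurable_fun setT (fun y => k (f y)).
  by apply: measurableT_comp => //; exact: continuous_measurable_fun.
have mG : measurable_fun `]delta, +oo[ G.
  apply: open_continuous_measurable_fun; first exact: interval_open.
  by move=> u; rewrite inE/= in_itv/= andbT; exact: cG.
have e_lt y : 0 < y -> exists n, e n <= y.
  move=> y0; exists (Num.truncn (r / y)).
  by rewrite ler_pdivrMr// mulrC -ler_pdivrMr// ltW// truncnS_gt.
have e_nd m n : (m <= n)%N -> e n <= e m.
  by move=> mn; rewrite ler_pM2l// lef_pV2 ?posrE// ler_nat ltnS.
(* As [e n] decreases to 0, the intervals increase to the one that is open at [delta]. *)
have L : (\int[mu]_(u in `[f (e n), f r]) (G u)%:E @[n --> \oo] -->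
    \int[mu]_(u in `]delta, f r]) (G u)%:E)%E.
  rewrite (_ : `]delta, f r]%classic = \bigcup_n `[f (e n), f r]%classic).
    apply: ge0_nondecreasing_set_cvg_integral => //.
    - move=> m n mn; apply/subsetPset => u /=; rewrite !in_itv/= => /andP[eu ->].
      by rewrite andbT (le_trans _ eu)// f_le ?(ltW (e0 _))// e_nd.
    - move=> n; apply/measurable_EFinP; apply: measurable_funS mG => //.
      move=> u /=; rewrite !in_itv/= andbT => /andP[eu _].
      by apply: lt_le_trans eu; exact: f0.
    - by move=> n u _; rewrite lee_fin mulr_ge0// invr_ge0 sqrtr_ge0.
  apply/seteqP; split=> u /=.
    rewrite in_itv/= => /andP[du ur].
    (* The nonnegative solution of [f y = u]. *)
    pose y := zeta * Num.sqrt (u - delta).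
    have y0 : 0 < y by rewrite mulr_gt0// sqrtr_gt0 subr_gt0.
    have fy : f y = u.
      rewrite /f /y mulrAC mulfV ?gt_eqF// mul1r sqr_sqrtr ?subr_ge0 ?ltW//.
      by ring.
    have [n ny] := e_lt y y0; exists n => //=.
    by rewrite in_itv/= ur andbT -fy f_le ?(ltW (e0 _))// ltW.
  move=> [n _ /=]; rewrite !in_itv/= => /andP[eu ->]; rewrite andbT.
  by apply: lt_le_trans eu; exact: f0.
have K : (\int[mu]_(y in `[e n, r]) ((2 / zeta)%:E * (k (f y))%:E) @[n --> \oo] -->
    \int[mu]_(y in `]0%R, r]) ((2 / zeta)%:E * (k (f y))%:E))%E.
  rewrite (_ : `]0, r]%classic = \bigcup_n `[e n, r]%classic).
    apply: ge0_nondecreasing_set_cvg_integral => //.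
    - move=> m n mn; apply/subsetPset => y /=; rewrite !in_itv/= => /andP[ey ->].
      by rewrite andbT (le_trans _ ey)// e_nd.
    - move=> n; apply: measurable_funTS; apply: emeasurable_funM => //.
      exact/measurable_EFinP.
    - by move=> n y _; rewrite mule_ge0// lee_fin// divr_ge0// ltW.
  apply/seteqP; split=> y /=.
    rewrite in_itv/= => /andP[y0 yr].
    have [n ny] := e_lt y y0; exists n => //=.
    by rewrite in_itv/= ny.
  move=> [n _ /=]; rewrite !in_itv/= => /andP[ey ->]; rewrite andbT.
  exact: lt_le_trans ey.
rewrite [X in X @ _ --> _](_ : _ = (fun n =>
    \int[mu]_(y in `[e n, r]) ((2 / zeta)%:E * (k (f y))%:E)))%E in L; last first.
  exact/funext.
have := cvg_unique _ L K => LK.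
rewrite -ge0_integralZl//; last 3 first.
- by apply: measurable_funTS; exact/measurable_EFinP.
- by move=> y _; rewrite lee_fin.
- by rewrite lee_fin divr_ge0// ltW.
(* The endpoint [delta], where the integrand has its default value 0, is a null set. *)
rewrite -integral_itv_obnd_cbnd; last first.
  apply/measurable_EFinP; apply: measurable_funS mG => //.
  by move=> u /=; rewrite !in_itv/= andbT => /andP[].
rewrite -[RHS]integral_itv_obnd_cbnd; last first.
  by apply: measurable_funTS; apply: emeasurable_funM => //; exact/measurable_EFinP.
by rewrite addrC; exact: LK.
Qed.

End change_of_variables.

(** * Distances in the plane and the path loss ratio *)

Section plane.
Context (R : realType).

Lemma enorm_col2 (x : 'cV[R]_2) : enorm x = Num.sqrt (x 0 0 ^+ 2 + x 1 0 ^+ 2).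
Proof.
rewrite /enorm !big_ord_recl big_ord0 addr0.
by congr (Num.sqrt (_ + x _ _ ^+ 2)); exact: val_inj.
Qed.

Lemma enorm_gt0 (x : 'cV[R]_2) : x != 0 -> 0 < enorm x.
Proof.
move=> x0; rewrite /enorm sqrtr_gt0 lt0r sumr_ge0 ?andbT; last first.
  by move=> i _; exact: sqr_ge0.
apply: contra_neq x0 => /eqP; rewrite psumr_eq0; last first.
  by move=> i _; exact: sqr_ge0.
move=> /allP x0; apply/matrixP => i j; rewrite !mxE (ord1 j).
by have := x0 i (mem_index_enum i); rewrite implyTb sqrf_eq0 => /eqP.
Qed.

Lemma enorm_roads (x y : R) :
  enorm (x *: ex - y *: ey) = Num.sqrt (x ^+ 2 + y ^+ 2).
Proof.
rewrite enorm_col2 !mxE/=; congr Num.sqrt; ring.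
Qed.

Lemma enorm_ex (x : R) : enorm (x *: ex) ^+ 2 = x ^+ 2.
Proof.
rewrite -[x *: ex]subr0 -(scale0r ey) enorm_roads sqr_sqrtr; first by ring.
by rewrite addr_ge0 ?sqr_ge0.
Qed.

End plane.

(** For [x = +oo] both sides are 0, since [fine] sends [+oo] to 0 and [0 * +oo = 0]. *)
Lemma fineMl (R : realType) (c : R) (x : \bar R) : 0 <= c -> (0 <= x)%E ->
  fine (c%:E * x)%E = c * fine x.
Proof.
move=> c0; case: x => [x| |//] _ //=.
rewrite mulr0; move: c0; rewrite le_eqVlt => /predU1P[<-|c0].
  by rewrite mul0e.
by rewrite gt0_muley.
Qed.

Lemma suburban_ratio (R : realType) (alpha beta A0 q r : R) :
  0 < alpha -> 0 < beta -> 0 < A0 -> 0 < q -> 0 < r ->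
  1 - (1 + beta / (A0 * q `^ (- alpha)) * (A0 * r `^ (- alpha)))^-1 =
  (1 + ((r / (beta `^ alpha^-1 * q)) ^+ 2) `^ (alpha / 2))^-1.
Proof.
move=> alpha0 beta0 A00 q0 r0.
set zeta := _ * q.
have zeta0 : 0 < zeta by rewrite mulr_gt0// powR_gt0.
have rz0 : 0 <= r / zeta by rewrite divr_ge0 ?ltW.
have -> : ((r / zeta) ^+ 2) `^ (alpha / 2) = r `^ alpha / (beta * q `^ alpha).
  rewrite -powR_mulrn// -powRrM mulrCA mulfV ?mulr1//.
  rewrite powRM ?invr_ge0 ?ltW//; congr (_ * _).
  rewrite -powR_inv1 ?ltW// powRAC powR_inv1 ?powR_ge0//; congr (_^-1).
  rewrite /zeta powRM ?powR_ge0 ?ltW//; congr (_ * _).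
  by rewrite -powRrM mulVf ?gt_eqF// powRr1// ltW.
rewrite !powRN.
have qa : 0 < q `^ alpha by exact: powR_gt0.
have ra : 0 < r `^ alpha by exact: powR_gt0.
have ? : 0 < beta * q `^ alpha by exact: mulr_gt0.
field; rewrite !gt_eqF//=.
by rewrite addr_gt0.
Qed.

Theorem proposition2 (R : realType) (d : measure_display)
  (T : measurableType d) (P : probability T R)
  (alpha beta A0 Ry lambday pI xrx xtx ytx : R)
  (N : {RV P >-> nat}) (Y F : nat -> {RV P >-> R}) :
  1 < alpha -> 0 < beta -> 0 < A0 -> 0 < Ry -> 0 < lambday -> 0 <= pI <= 1 ->
  let vrx : 'cV[R]_2 := xrx *: ex in
  let vtx : 'cV[R]_2 := xtx *: ex + ytx *: ey in
  xtx * ytx = 0 -> vtx <> vrx ->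
  homogeneous_poisson_process (pI * lambday) [set y | `|y| <= Ry] N Y ->
  iid_exponential_marks N Y F ->
  let lpl := suburban_path_loss A0 alpha in
  let zeta := beta `^ alpha^-1 * enorm (vrx - vtx) in
  let calY := h_circ alpha ((enorm vrx / zeta) ^+ 2) ((Ry / zeta) ^+ 2) in
  P_circ P beta lpl vtx vrx N (fun i w => Y i w *: ey) (fun i => F i : T -> R) =
  (expR (- pI * lambday * zeta * calY))%:E.
Proof.
move=> alpha1 beta0 A00 Ry0 lam0 /andP[pI0 _] vrx vtx _ vtx_rx poissonNY marksF
  lpl zeta calY.
have alpha0 : 0 < alpha by exact: lt_trans alpha1.
have q0 : 0 < enorm (vrx - vtx).
  by apply: enorm_gt0; rewrite subr_eq0; apply/eqP => /esym.
have zeta0 : 0 < zeta by rewrite mulr_gt0// powR_gt0.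
pose r (y : R) := Num.sqrt (xrx ^+ 2 + y ^+ 2).
pose beta' := beta / lpl vtx vrx.
have lplE y : lpl (y *: ey) vrx = A0 * r y `^ (- alpha).
  by rewrite /lpl /suburban_path_loss enorm_roads.
pose l y := beta' * lpl (y *: ey) vrx.
have beta'0 : 0 <= beta'.
  by rewrite divr_ge0 ?ltW// mulr_gt0// powR_gt0.
have l0 y : 0 <= l y by rewrite mulr_ge0// lplE mulr_ge0 ?powR_ge0// ltW.
have cr : continuous r.
  move=> y; apply: continuous_cvg; first exact: sqrt_continuous.
  by apply: cvgD; [exact: cvg_cst|exact: exprn_continuous].
have ml : measurable_fun setT l.
  rewrite (_ : l = fun y => beta' * (A0 * (r y `^ (- alpha)))); last first.
    by apply/funext => y; rewrite /l lplE.
  apply: measurable_funM => //; apply: measurable_funM => //.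
  apply: (measurableT_comp (measurable_powR _)).
  exact: continuous_measurable_fun.
pose D := [set y : R | `|y| <= Ry].
have DE : D = `[- Ry, Ry]%classic.
  by apply/seteqP; split=> y; rewrite /D/= in_itv/= ler_norml.
have mD : measurable D by rewrite DE.
have finD : (lebesgue_measure D < +oo)%E.
  by rewrite DE lebesgue_measure_itv/=; case: ifP => _; rewrite -?EFinB ltry.
have lam_ge0 : 0 <= pI * lambday by rewrite mulr_ge0// ltW.
(* The factor [beta'] is absorbed into the path loss, which gives the form required by
   [laplace_functional]. *)
transitivity (\int[P]_w (expR (- \sum_(i < N w) F i w * l (Y i w)))%:E)%E.
  rewrite /P_circ unlock; apply: eq_integral => w _.
  rewrite -/beta' /interference mulNr mulr_sumr.
  congr (expR (- _))%:E; apply: eq_bigr => i _.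
  by rewrite mulrCA.
rewrite (laplace_functional poissonNY marksF)//; congr (expR _)%:E.
rewrite !mulNr -(mulrA _ zeta); congr (- (_ * _)).
pose delta := (enorm vrx / zeta) ^+ 2.
have delta0 : 0 <= delta by rewrite sqr_ge0.
pose k (u : R) := (1 + u `^ (alpha / 2))^-1.
have k0 u : 0 <= k u by rewrite invr_ge0 addr_ge0// powR_ge0.
have mk : measurable_fun setT k.
  by apply: measurable_inv1D => [|u]; [exact: measurable_powR|exact: powR_ge0].
have ck : {in `]0, +oo[, continuous k}.
  move=> u u0; apply: cvgV; first by rewrite gt_eqF// ltr_wpDr// powR_ge0.
  apply: cvgD; first exact: cvg_cst.
  have /derivable1_diffP/differentiable_continuous :=
    @derivable_powR R 1 (alpha / 2) u u0.
  exact.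
have mkf : measurable_fun setT (fun y : R => k (delta + (y / zeta) ^+ 2)).
  apply: measurableT_comp => //; apply: measurable_funD => //.
  by apply: measurable_funX; exact: measurable_funM.
have -> : (\int[lebesgue_measure]_(y in D) (1 - (1 + l y)^-1)%:E =
    \int[lebesgue_measure]_(y in `[(- Ry)%R, Ry]) (k (delta + (y / zeta) ^+ 2))%:E)%E.
  (* The null point [y = 0] is removed: if [xrx = 0], the receiver is there, and the default value
     of the path loss makes the left integrand 0 while the right one is 1. *)
  rewrite DE -(@integral_setD1 R _ 0); last 2 first.
  - exact: measurableD.
  - apply: measurable_funTS; apply/measurable_EFinP; apply: measurable_funB => //.
    exact: measurable_inv1D.
  rewrite -[RHS](@integral_setD1 R _ 0); last 2 first.
  - exact: measurableD.
  - by apply: measurable_funTS; exact/measurable_EFinP.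
  apply: eq_integral => y; rewrite inE/= => -[_ /eqP y0]; congr EFin.
  have r0 : 0 < r y.
    by rewrite sqrtr_gt0 ltr_wpDl ?sqr_ge0// exprn_even_gt0.
  rewrite /l lplE /beta' /lpl /suburban_path_loss suburban_ratio//.
  rewrite /k /delta -/zeta; congr ((1 + _ `^ _)^-1).
  rewrite !expr_div_n enorm_ex sqr_sqrtr ?addr_ge0 ?sqr_ge0//.
  by rewrite mulrDl.
rewrite ge0_integral_itv_even//; last 2 first.
- exact: ltW.
- by move=> y; rewrite mulNr sqrrN.
have := ge0_integral_sqrt_substitution delta0 zeta0 Ry0 ck mk k0.
set I := (\int[lebesgue_measure]_(y in `[0%R, Ry]) _)%E => HI.
have I0 : (0 <= I)%E by apply: integral_ge0 => y _; rewrite lee_fin.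
(* Hence [zeta * calY] is twice the integral over the upper half of the road, which matches the
   factor 2 from evenness. *)
have -> : calY = fine ((2 / zeta)%:E * I)%E.
  rewrite -HI /calY /h_circ /Rintegral -/delta; congr fine.
  apply: eq_integral => u _; congr EFin.
  by rewrite /k invfM.
rewrite !fineMl// ?divr_ge0 ?ltW//.
by field; rewrite gt_eqF.
Qed.
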